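(* Let $k \geq 2$ be an integer, let $\{t_n\}_{n\geq 0}$ be the $2k$-nacci sequence, and let $d$ be a fixed positive integer. Then the equation $$m! = \prod_{i=1}^d t_{n_i}$$ has only a finite number of solutions in positive integers $m, n_1, n_2, \ldots, n_d$, and this number can be effectively bounded from above.
   Context: The $2k$-nacci sequence $\{t_n\}_{n\geq 0}$ is defined by $t_0 = 0$, $t_n = 1$ for $1 \leq n \leq 2k-1$, and $t_n = \sum_{i=1}^{2k} t_{n-i}$ for $n \geq 2k$. *)

(* Defs.v *)
From HB Require Import structures.
From mathcomp Require Import all_boot.
From mathcomp Require Import finmap.
From mathcomp Require Import classical_sets cardinality.

Set Implicit Arguments.
Unset Strict Implicit.
Unset Printing Implicit Defensive.

Local Open Scope nat_scope.

(* The list t_n, t_(n-1), ..., t_0 (most recent term first) of the first terms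
   of the sequence of order K. *)
Fixpoint nacci_rev (K n : nat) : seq nat :=
  if n is n'.+1 then
    let s := nacci_rev K n' in
    (if n < K then 1 else sumn (take K s)) :: s
  else [:: 0].

(* The 2k-nacci sequence is [nacci (2 * k)]; its defining equations are
   [nacci0], [nacci1] and [nacci_rec]. *)
Definition nacci (K n : nat) : nat := head 0 (nacci_rev K n).

Lemma nacci0 (K : nat) : nacci K 0 = 0.
Proof. by []. Qed.

Lemma nacci1 (K n : nat) : 0 < n < K -> nacci K n = 1.
Proof. by case: n => // n /andP[_ nK]; rewrite /nacci /= nK. Qed.

Lemma nacci_revE (K n : nat) :
  nacci_rev K n = [seq nacci K (n - i) | i <- iota 0 n.+1].
Proof.
elim: n => // n IHn.
transitivity (nacci K n.+1 :: nacci_rev K n) => //.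
rewrite IHn -[n.+2]add1n iotaD map_cat (iotaDl 1 0 n.+1) -map_comp.
rewrite [map _ (iota 0 1)]/= cat1s subn0.
by congr cons; apply: eq_map => i; rewrite [RHS]/= add1n subSS.
Qed.

Lemma nacci_rec (K n : nat) : 0 < K <= n ->
  nacci K n = \sum_(1 <= i < K.+1) nacci K (n - i).
Proof.
case: n => [|n] /andP[K0 Kn]; first by rewrite leqNgt K0 in Kn.
rewrite {1}/nacci /= ltnNge Kn /= nacci_revE -map_take take_iota.
rewrite (minn_idPl Kn) sumnE big_map -[K in iota 0 K]subn0 big_add1 /=.
by apply: eq_bigr => i _; rewrite subSS.
Qed.

(* Total recursive (computable) functions of n natural number arguments:
   Kleene's mu-recursive functions, with minimization restricted to functions
   that vanish somewhere for each value of the parameters.  In [recursive_prim]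
   the recursion is on the first argument, and [h] receives the index, the
   previous value and the parameters.  [recursive_ext] only serves to avoid
   relying on functional extensionality. *)
Inductive recursive : forall n : nat, (n.-tuple nat -> nat) -> Prop :=
| recursive_zero n : recursive (fun _ : n.-tuple nat => 0)
| recursive_succ : recursive (fun v : 1.-tuple nat => (thead v).+1)
| recursive_proj n (i : 'I_n) : recursive (fun v : n.-tuple nat => tnth v i)
| recursive_comp m n (g : m.-tuple nat -> nat)
    (h : 'I_m -> n.-tuple nat -> nat) :
    recursive g -> (forall i, recursive (h i)) ->
    recursive (fun v => g [tuple h i v | i < m])
| recursive_prim n (g : n.-tuple nat -> nat) (h : n.+2.-tuple nat -> nat) :
    recursive g -> recursive h ->
    recursive (fun v : n.+1.-tuple nat =>
      iteri (thead v) (fun i r => h [tuple of i :: r :: behead_tuple v])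
        (g (behead_tuple v)))
| recursive_mu n (g : n.+1.-tuple nat -> nat) (f : n.-tuple nat -> nat) :
    recursive g ->
    (forall v : n.-tuple nat, g [tuple of f v :: v] = 0 /\
       forall j, j < f v -> g [tuple of j :: v] <> 0) ->
    recursive f
| recursive_ext n (f g : n.-tuple nat -> nat) :
    recursive f -> f =1 g -> recursive g.

Definition recursive2 (B : nat -> nat -> nat) : Prop :=
  recursive (fun v : 2.-tuple nat => B (tnth v ord0) (tnth v ord_max)).

(* The n_i form an ordered d-tuple, so solutions differing by a permutation of
   the n_i are distinct. *)
Definition solutions (k d : nat) : set (nat * d.-tuple nat) :=
  [set x | [/\ 0 < x.1, forall i : 'I_d, 0 < tnth x.2 i &
               x.1`! = \prod_(i < d) nacci (2 * k) (tnth x.2 i)]]%classic.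

Arguments solutions : clear implicits.

(* Main.v *)
Require Import Defs.
From mathcomp Require Import all_boot all_algebra.
From mathcomp Require Import finmap.
From mathcomp Require Import classical_sets cardinality.
From mathcomp Require Import zify ring.

Set Implicit Arguments.
Unset Strict Implicit.
Unset Printing Implicit Defensive.

Import GRing.Theory.

Local Open Scope nat_scope.

(** The idea is to compare powers of 2. On the one hand 2 ^ m./2 divides m`!. On
the other hand the terms of the 2k-nacci sequence contain very few factors 2:
writing K = 2k and v for the 2-adic valuation,

 - v (t_n) = 0 if K + 1 does not divide n;
 - v (t_n) = 1 if n = (K + 1) J with J odd;
 - v (t_n) = 1 + v (J) + v (K - 2) if n = (K + 1) J with J even,

so 2 ^ v (t_n) <= 2 n K always ([pfactor_nacci_le]). As t_n grows exponentially
([leq_exp2_nacci]), t_n <= m`! <= 2 ^ (m * m) forces n = O(m ^ 2). A solution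
thus satisfies 2 ^ m./2 <= (2 (K + 1 + 2 m ^ 2) K) ^ d, where the right-hand
side is polynomial in m. This bounds m, hence the n_i, by explicit functions of
k and d.

The valuation comes from a closed formula. The recurrence gives
t_(n+1) = 2 t_n - t_(n-K), and the generating function of the sequence is

   x / (1 - x) + x^K (K - 2 + x) / (1 - 2 x + x^(K+1)),

so t_(n+K+1) = 1 + (K - 2) u_(n+1) + u_n ([nacci_useq]), where
1 / (1 - 2 x + x^(K+1)) = sum_n u_n x^n. Expanding the latter in powers of
2 x - x^(K+1),

   u_n = sum_i (-1)^i 2^(n - (K+1) i) C(n - K i, i).

For n = (K+1) j + r with r <= K, the term i = j dominates 2-adically: every other
nonzero term is some +/- 2^M C(X, M) with M > K, where the M consecutive factors
in the numerator of C(X, M) straddle J = j + 1: say that b of them are smaller.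
One of these factors being J, this term is divisible by 2^(v(J) + M - e) whenever 2^e bounds the 2-part of
M C(M - 1, b) ([bin_straddle]); the latter is at most M because M C(M - 1, b) is
an entry of the Leibniz harmonic triangle ([logn_leibniz]). Hence modulo
2^(v(J) + v(K-2) + 2) the terms u_((K+1) j) and u_((K+1) j + 1) are (-1)^j and
(-1)^j 2 J, and t_((K+1) J) is -2 J (K-2) or 2 + 2 J (K-2) according to the
parity of J. *)

(** * The Leibniz harmonic triangle *)

(** With a(m, l) = m C(m - 1, l), this and the next lemma together amount to the
relation 1 / a(m, l+1) = 1 / a(m-1, l) - 1 / a(m, l) between entries of the
Leibniz harmonic triangle. *)
Lemma leibniz_triangle s l :
  (s.+2 * 'C(s.+1, l.+1)) * (l.+1 * 'C(s.+1, l))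
  = (s.+1 * 'C(s, l)) * (s.+2 * 'C(s.+1, l)).
Proof. by rewrite (mul_bin_diag s.+1 l); ring. Qed.

Lemma leibniz_triangleD s l : l <= s ->
  s.+2 * 'C(s.+1, l) = s.+1 * 'C(s, l) + l.+1 * 'C(s.+1, l).
Proof.
move=> ls; have := mul_bin_left s.+1 l; have := mul_bin_diag s.+1 l => /= E E'.
by rewrite E E' -mulnDl; congr (_ * _); lia.
Qed.

(** By the relation above, the valuation of a(m, l+1) is at most the larger of
those of a(m-1, l) and a(m, l), so the bound propagates from the first column
a(m, 0) = m. (In fact a(m, l) divides the least common multiple of 1, ..., m.) *)
Lemma logn_leibniz p m l e : l < m -> m < p ^ e.+1 ->
  logn p (m * 'C(m.-1, l)) <= e.
Proof.
have [p_pr|] := boolP (prime p); last first.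
  by move=> np _ _; rewrite lognE (negbTE np).
elim: l m => [|l IHl] [//|[|s]] //= lm me.
- by rewrite bin0 muln1 logn1.
- rewrite bin0 muln1.
  have: p ^ logn p s.+2 < p ^ e.+1.
    by apply: leq_ltn_trans me; apply: dvdn_leq => //; apply: pfactor_dvdnn.
  by rewrite ltn_exp2l ?prime_gt1.
have ls : l <= s by lia.
have x_le : logn p (s.+1 * 'C(s, l)) <= e by apply: (IHl s.+1); lia.
have y_le : logn p (s.+2 * 'C(s.+1, l)) <= e by apply: (IHl s.+2); lia.
have C0 : 0 < 'C(s.+1, l) by rewrite bin_gt0; lia.
have D0 : 0 < 'C(s, l) by rewrite bin_gt0.
have D1 : 0 < 'C(s.+1, l.+1) by rewrite bin_gt0.
have := congr1 (logn p) (leibniz_triangle s l).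
have xy := leibniz_triangleD ls.
set x := s.+1 * _ in x_le xy *; set y := s.+2 * 'C(s.+1, l) in y_le xy *.
set z := s.+2 * _; set w := l.+1 * _ in xy *.
have x0 : 0 < x by rewrite muln_gt0.
have y0 : 0 < y by rewrite muln_gt0.
have z0 : 0 < z by rewrite muln_gt0.
have w0 : 0 < w by rewrite muln_gt0.
clearbody x y z w; rewrite !lognM // => E.
(* In E the valuation of w cancels the smaller of those of x and y. *)
have mn_w : minn (logn p x) (logn p y) <= logn p w.
  rewrite -pfactor_dvdn // -(dvdn_addr w (m := x)).
    by rewrite -xy pfactor_dvdn // geq_minr.
  by rewrite pfactor_dvdn // geq_minl.
lia.
Qed.

(** * Binomial coefficients divisible by a factor of their numerator *)

(** The numerator of C(J + a, a + b + 1) is the product of the a factors above J,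
of J itself and of the b factors below J; the first and the last groups are, up
to a`! and b`!, the binomial coefficients on the right. *)
Lemma bin_straddle J a b : 0 < J ->
  (a + b).+1 * 'C(a + b, b) * 'C(J + a, (a + b).+1)
  = J * 'C(J + a, a) * 'C(J.-1, b).
Proof.
case: J => // j _ /=.
have [jb|bj] := ltnP j b.
  by rewrite (bin_small jb) (@bin_small (j.+1 + a)) ?muln0 //; lia.
have E1 := bin_fact (leq_addl a b).
have E2 := @bin_fact (j.+1 + a) (a + b).+1 ltac:(lia).
have E3 := bin_fact (leq_addl j.+1 a).
have E4 := bin_fact bj.
rewrite addnK in E1; rewrite addnK in E3.
have E5 : j.+1 + a - (a + b).+1 = j - b by lia.
rewrite E5 factS in E2; rewrite (factS j) in E3.
apply/eqP; rewrite -(@eqn_pmul2r (b`! * a`! * (j - b)`!)) ?muln_gt0 ?fact_gt0 //.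
apply/eqP; transitivity ((j.+1 + a)`!).
  by rewrite -E2 -E1; ring.
by rewrite -E3 -E4; ring.
Qed.

Lemma ltn_quad_exp2 m : 5 <= m -> 2 * m * (m - 3) < 2 ^ m.
Proof.
elim: m => // m IHm; rewrite leq_eqVlt => /predU1P[<- //|].
by rewrite ltnS => /[dup] m5 /IHm; rewrite expnS; nia.
Qed.

(** The exponent of 2 gained, (a + b).+1, exceeds what is lost to the denominator
(a logarithm of it, by [logn_leibniz]) by enough to cover v(K - 2) + 2, as
4 m (m - 3) < 2 ^ m.+1 for m = a + b + 1 > K ([ltn_quad_exp2]). *)
Lemma dvdn_straddle K J a b : 4 <= K -> 0 < J -> K <= a + b ->
  2 ^ (logn 2 J + logn 2 (K - 2)).+2 %| 2 ^ (a + b).+1 * 'C(J + a, (a + b).+1).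
Proof.
move=> K4 J0; set m := (a + b).+1 => Km.
have [->|C0] := posnP 'C(J + a, m); first by rewrite muln0 dvdn0.
rewrite pfactor_dvdn ?muln_gt0 ?expn_gt0 // lognM ?expn_gt0 // pfactorK //.
have lead0 : 0 < m * 'C(a + b, b) by rewrite muln_gt0 bin_gt0 leq_addl.
have /(congr1 (logn 2)) := bin_straddle a b J0.
have prod0 : 0 < 'C(J + a, a) * 'C(J.-1, b).
  have: 0 < m * 'C(a + b, b) * 'C(J + a, m) by rewrite muln_gt0 lead0.
  by rewrite bin_straddle // -mulnA muln_gt0 => /andP[].
rewrite -/m lognM // -mulnA [in RHS]lognM // => E.
set e := trunc_log 2 m.
have le_e : logn 2 (m * 'C(m.-1, b)) <= e.
  by apply: logn_leibniz; [rewrite /m; lia | apply: trunc_log_ltn].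
have em : 2 ^ e <= m by apply: trunc_logP.
have cK : 2 ^ logn 2 (K - 2) <= K - 2.
  by apply: dvdn_leq; [lia | apply: pfactor_dvdnn].
suff: e + logn 2 (K - 2) + 1 < m by move: le_e E; rewrite /m /=; lia.
rewrite -(ltn_exp2l _ _ (ltnSn 1)) !expnD expn1.
by have := @ltn_quad_exp2 m; rewrite /m in em *; nia.
Qed.

(** * The inverse of 1 - 2 x + x^(K+1) *)

(** The contribution of (2 x - x^(K+1))^s, where s = n - K i, to the coefficient
of x^n in 1 / (1 - 2 x + x^(K+1)). When the truncated subtractions are not
faithful, i.e. when n < (K+1) i, the binomial coefficient vanishes. *)
Definition uterm (K n i : nat) : int :=
  ((-1) ^+ i * (2 ^ (n - K.+1 * i) * 'C(n - K * i, i))%N%:Z)%R.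

Definition useq (K n : nat) : int := (\sum_(i < n.+1) uterm K n i)%R.

Lemma uterm_small K n i : n < K.+1 * i -> uterm K n i = 0%R.
Proof. by move=> ni; rewrite /uterm bin_small ?muln0 ?mulr0 //; nia. Qed.

Lemma useq_widen K n N : n < N -> useq K n = (\sum_(i < N) uterm K n i)%R.
Proof.
move=> nN; rewrite /useq (big_ord_widen N (uterm K n)) // big_mkcond /=.
by apply: eq_bigr => i _; case: ltnP => // ni; rewrite uterm_small //; nia.
Qed.

Lemma utermS0 K n : uterm K n.+1 0 = (2 * uterm K n 0)%R.
Proof. by rewrite /uterm !muln0 !subn0 !bin0 expnS -mulnA PoszM; ring. Qed.

(** Pascal's rule: multiplying (2 x - x^(K+1))^s by one more factor. *)
Lemma utermS K n i :
  uterm K n.+1 i.+1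
  = (2 * uterm K n i.+1 - (if (K <= n)%N then uterm K (n - K)%N i else 0))%R.
Proof.
have [ni|ni] := ltnP n.+1 (K.+1 * i.+1).
  rewrite !(uterm_small (i := i.+1)) ?mulr0; try lia.
  by case: leqP => Kn; rewrite ?subr0 // uterm_small ?subr0 //; nia.
have Kn : K <= n by nia.
rewrite Kn /uterm.
have -> : n.+1 - K * i.+1 = (n - K * i.+1).+1 by nia.
rewrite binS.
have -> : n - K - K * i = n - K * i.+1 by lia.
have -> : n - K - K.+1 * i = n.+1 - K.+1 * i.+1 by lia.
have [ni'|ni'] := eqVneq n.+1 (K.+1 * i.+1).
  by rewrite (@bin_small _ i.+1) ?exprS; [ring | nia].
have -> : n.+1 - K.+1 * i.+1 = (n - K.+1 * i.+1).+1 by lia.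
by rewrite expnS exprS !PoszM PoszD; ring.
Qed.

Lemma useqS K n : 0 < K ->
  useq K n.+1
  = (2 * useq K n - (if (K <= n)%N then useq K (n - K)%N else 0))%R.
Proof.
move=> K0; rewrite (useq_widen K (ltnSn n.+1)) big_ord_recl utermS0.
rewrite (@useq_widen K n n.+2 (leqnSn _)) [in RHS]big_ord_recl mulrDr -addrA.
congr (_ + _)%R.
under eq_bigr do rewrite utermS.
rewrite big_split /= -big_distrr /= sumrN; congr (_ - _)%R.
by case: leqP => Kn; [rewrite (@useq_widen K (n - K) n.+1) //; lia|rewrite big1].
Qed.

(** * The closed formula for the terms of the sequence *)

Lemma nacciS K n : 0 < K <= n -> nacci K n.+1 + nacci K (n - K) = 2 * nacci K n.
Proof.
case: K => // K /= Kn; have KSn : 0 < K.+1 <= n.+1 by rewrite /= leqW.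
rewrite nacci_rec // big_add1 succnK big_mkord.
rewrite big_ord_recl subSS subn0 -addnA mul2n -addnn; congr (_ + _).
rewrite [RHS]nacci_rec // big_add1 succnK big_mkord big_ord_recr.
by congr (_ + _); apply: eq_bigr => i _; rewrite subSS.
Qed.

Lemma nacci_order K : 0 < K -> nacci K K = K.-1.
Proof.
case: K => // K _; rewrite nacci_rec ?leqnn // big_add1 /= big_mkord big_ord_recr.
rewrite /= subnn nacci0 addn0 (eq_bigr (fun=> 1)) ?sum1_card ?card_ord // => i _.
by rewrite nacci1 // subSS; have := ltn_ord i; lia.
Qed.

(** Both sides satisfy the recurrence of [nacciS]. The proof starts below the
index K + 1 by means of v, the sequence u delayed by K, i.e. the coefficients of
x^K / (1 - 2 x + x^(K+1)). *)
Lemma nacci_useq K n : 1 < K ->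
  Posz (nacci K (n + K.+1)%N) = (1 + (K - 2)%N%:Z * useq K n.+1 + useq K n)%R.
Proof.
move=> K1; pose v n := if K <= n then useq K (n - K) else 0%R.
have vS m : K <= m -> v m.+1 = (2 * v m - v (m - K)%N)%R.
  by move=> Km; rewrite /v Km leqW // subSn // useqS // ltnW.
have u0 : useq K 0 = 1%R by rewrite /useq big_ord1 /uterm /= expr0 !muln0.
have vlt m : m < K -> v m = 0%R by rewrite /v ltnNge => /negbTE->.
have vK : v K = 1%R by rewrite /v leqnn subnn.
suff E m : Posz (nacci K m.+1) = (1 + (K - 2)%N%:Z * v m.+1 + v m)%R.
  by rewrite addnS E /v -addSn !addnK !leq_addl.
elim/ltn_ind: m => m IHm.
have [mK|Km] := ltnP m.+1 K.
  by rewrite nacci1 ?mK // !vlt //; lia.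
move: Km; rewrite leq_eqVlt => /predU1P[Km|Km].
  by rewrite -Km nacci_order ?vK ?vlt; lia.
have := nacciS (K := K) (n := m) ltac:(lia).
move: Km; rewrite ltnS leq_eqVlt => /predU1P[Km|Km].
  by rewrite -Km subnn nacci0 vS // nacci_order ?vK ?subnn ?vlt; lia.
have Em := IHm m.-1 ltac:(lia); have EmK := IHm (m - K).-1 ltac:(lia).
have vm := vS m.-1 ltac:(lia).
rewrite !prednK in Em EmK vm; try lia.
have mK : m.-1 - K = (m - K).-1 by lia.
rewrite mK in vm; rewrite vS 1?ltnW // => E.
have -> : Posz (nacci K m.+1) = (2 * (nacci K m)%:Z - (nacci K (m - K)%N)%:Z)%R.
  by lia.
by rewrite Em EmK vm; ring.
Qed.

(** Since (K+1) j + r - K i = (j + 1) + (K (j - i) + r - 1), the term of index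
i < j is a binomial coefficient whose numerator straddles j + 1, with j - i
factors below and K (j - i) + r - 1 above; the terms of index i > j vanish. *)
Lemma useq_main_term K j r : 4 <= K -> r <= K ->
  (Posz (2 ^ (logn 2 j.+1 + logn 2 (K - 2)).+2)%N %|
    useq K (K.+1 * j + r)%N - (-1) ^+ j * (2 ^ r * 'C(j + r, j))%N%:Z)%Z%R.
Proof.
move=> K4 rK; set n := K.+1 * j + r.
have jn : j < n.+1 by rewrite /n; nia.
rewrite /useq (bigD1 (Ordinal jn)) //=.
have -> : uterm K n j = ((-1) ^+ j * (2 ^ r * 'C(j + r, j))%N%:Z)%R.
  rewrite /uterm; have -> : n - K.+1 * j = r by rewrite /n; lia.
  by have -> : n - K * j = j + r by rewrite /n; lia.
rewrite addrAC subrr add0r; apply: rpred_sum => i.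
have -> : (i != Ordinal jn) = (i != j :> nat) by [].
move: (nat_of_ord i) => {}i ne.
have [ij|ji] := ltnP i j; last first.
  rewrite uterm_small ?rpred0 //.
  have ij : j < i.
    by rewrite ltn_neqAle ji andbT eq_sym.
  by apply: leq_trans (leq_mul (leqnn _) ij); rewrite /n; lia.
have [l l0 jE] : exists2 l, 0 < l & j = i + l by exists (j - i); lia.
have nE : n - K * i = j.+1 + (K * l + r).-1 by rewrite /n jE; nia.
have mE : n - K.+1 * i = ((K * l + r).-1 + l).+1 by rewrite /n jE; nia.
rewrite /uterm nE mE -(@bin_sub _ i); last by lia.
have -> : j.+1 + (K * l + r).-1 - i = ((K * l + r).-1 + l).+1 by lia.
by rewrite dvdz_mull // dvdzE dvdn_straddle //; nia.
Qed.

(** * The 2-adic valuation of the terms *)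

(** Modulo 2 the sequence has period K + 1, by [nacciS], and only its first term
among t_0, ..., t_K is even. *)
Lemma odd_nacci K n : 0 < K -> ~~ odd K -> ~~ (K.+1 %| n) -> odd (nacci K n).
Proof.
move=> K0 Keven; elim/ltn_ind: n => n IHn nK.
have n0 : 0 < n by case: n nK {IHn}; rewrite ?dvdn0.
have [Kn|] := leqP K.+1 n.
  have /(congr1 odd) := @nacciS K n.-1 ltac:(lia).
  rewrite prednK // oddD oddM /=.
  have -> : n.-1 - K = n - K.+1 by lia.
  rewrite (IHn (n - K.+1)); [by case: odd | by lia |].
  by rewrite -(@dvdn_addr K.+1) ?subnKC.
rewrite ltnS leq_eqVlt => /predU1P[->|nltK]; last by rewrite nacci1 ?n0.
by rewrite nacci_order //; case: (K) K0 Keven => //= K' _; rewrite negbK.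
Qed.

(** The closed formula at the index (K+1) (j+1), with both terms of u replaced by
their dominant parts. *)
Lemma dvdz_nacci_main K j : 4 <= K ->
  (Posz (2 ^ (logn 2 j.+1 + logn 2 (K - 2)).+2)%N %|
    (nacci K (K.+1 * j.+1)%N)%:Z
    - (1 + (-1) ^+ j * (2 * j.+1 * (K - 2) + 1)%N%:Z))%Z%R.
Proof.
move=> K4; set D := Posz (2 ^ _).
rewrite (mulnSr K.+1) nacci_useq; last by lia.
have D1 : (D %| useq K (K.+1 * j + 1)%N - (-1) ^+ j * (2 * j.+1)%N%:Z)%Z%R.
  by have := @useq_main_term K j 1 K4; rewrite (addn1 j) binSn expn1; apply; lia.
have D0 : (D %| useq K (K.+1 * j)%N - (-1) ^+ j)%Z%R.
  by have := @useq_main_term K j 0 K4 isT; rewrite !addn0 binn mulr1.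
have D2 := rpredD (dvdz_mull (K - 2)%N%:Z D1) D0.
rewrite -(addn1 (K.+1 * j)); set y := (X in (D %| X)%Z).
suff -> : y = ((K - 2)%N%:Z
                 * (useq K (K.+1 * j + 1)%N - (-1) ^+ j * (2 * j.+1)%N%:Z)
               + (useq K (K.+1 * j)%N - (-1) ^+ j))%R by exact: D2.
by rewrite /y PoszD (PoszM (2 * j.+1)); ring.
Qed.

Lemma pfactor_nacci_le K n : 4 <= K -> ~~ odd K -> 0 < n ->
  2 ^ logn 2 (nacci K n) <= 2 * n * K.
Proof.
move=> K4 Keven n0.
have [/dvdnP[J nJ]|nK] := boolP (K.+1 %| n); last first.
  have /negbTE ev : ~~ (2 %| nacci K n).
    by rewrite dvdn2 negbK odd_nacci // (leq_trans _ K4).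
  by rewrite lognE ev !andbF expn0; nia.
rewrite mulnC in nJ; case: J nJ n0 => [->|j ->]; first by rewrite muln0.
move=> _; set t := nacci K _; have := dvdz_nacci_main j K4; rewrite -/t.
set X := 2 * j.+1 * (K - 2).
set E := (logn 2 j.+1 + logn 2 (K - 2)).+1.
(* The modulus in dvdz_nacci_main is 2 ^ E.+1, just too large to divide X. *)
have logX : logn 2 X = E by rewrite /X !lognM //; lia.
have X0 : 0 < X by rewrite /X; nia.
have small e : ~~ (2 ^ e.+1 %| t) -> logn 2 t <= e.
  move=> nt; have t0 : 0 < t by case: (t) nt; rewrite ?dvdn0.
  by rewrite pfactor_dvdn // in nt; rewrite leqNgt.
have [jodd|jeven] := boolP (odd j); rewrite -signr_odd ?jodd ?(negbTE jeven).
  have -> : (t%:Z - (1 + (-1) ^+ true * (X + 1)%N%:Z) = (t + X)%N%:Z)%R.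
    by rewrite expr1 mulN1r; lia.
  rewrite dvdzE !absz_nat => DX.
  have tE : logn 2 t <= E.
    apply: small; apply/negP => Dt; move: DX.
    by rewrite dvdn_addr // pfactor_dvdn // logX ltnn.
  apply: (@leq_trans (2 ^ E)); first by rewrite leq_exp2l.
  apply: (@leq_trans X); last by rewrite /X; nia.
  by rewrite -logX; apply: dvdn_leq => //; apply: pfactor_dvdnn.
have -> : (t%:Z - (1 + (-1) ^+ false * (X + 1)%N%:Z) = t%:Z - (X + 2)%N%:Z)%R.
  by rewrite expr0 mul1r; lia.
move=> DX; apply: (@leq_trans (2 ^ 1)); last by nia.
rewrite leq_exp2l //; apply: small; apply/negP => Dt.
have D4 : (Posz (2 ^ 2)%N %| t%:Z - (X + 2)%N%:Z)%Z%R.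
  by apply: dvdz_trans DX; rewrite dvdzE !absz_nat dvdn_exp2l.
have : 2 ^ 2 %| X + 2.
  have /= : (Posz (2 ^ 2)%N %| t%:Z - (t%:Z - (X + 2)%N%:Z))%Z%R by apply: rpredB.
  by rewrite subKr dvdzE.
(* K is even, so X is a multiple of 4 and X + 2 is not. *)
have -> : X = 4 * (j.+1 * (K./2 - 1)) by rewrite /X; lia.
by rewrite dvdn_addr // dvdn_mulr.
Qed.

(** * The growth of the terms and of the factorial *)

Lemma nacci_addn_le K n : 1 < K <= n.+2 ->
  nacci K n + nacci K n.+1 <= nacci K n.+2.
Proof.
case/andP=> K1 Kn; rewrite (@nacci_rec K n.+2) ?(ltnW K1) //.
rewrite big_ltn ?ltnS; last exact: ltnW.
rewrite big_ltn // !subSS !subn0 addnA [nacci K n + _]addnC; exact: leq_addr.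
Qed.

Lemma leq_nacciS K n : 1 < K -> 0 < n -> nacci K n <= nacci K n.+1.
Proof.
case: n => // n K1 _; have [nK|Kn] := ltnP n.+2 K.
  by rewrite !nacci1 ?nK ?(ltnW nK).
by rewrite (leq_trans _ (nacci_addn_le _)) ?K1 ?leq_addl.
Qed.

Lemma nacci_gt0 K n : 1 < K -> 0 < n -> 0 < nacci K n.
Proof.
move=> K1; elim: n => // -[_ _|n IHn _]; first by rewrite nacci1.
by rewrite (leq_trans (IHn isT)) ?leq_nacciS.
Qed.

Lemma leq_exp2_nacci K n : 1 < K -> 0 < n -> 2 ^ (n - K)./2 <= nacci K n.
Proof.
move=> K1; elim/ltn_ind: n => n IHn n0.
have [nK|Kn] := ltnP n K.+2.
  have -> : (n - K)./2 = 0 by lia.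
  exact: nacci_gt0.
have [m mn] : exists m, n = m.+2 by exists n.-2; lia.
have -> : (n - K)./2 = (m - K)./2.+1 by lia.
have := IHn m ltac:(lia) ltac:(lia); rewrite expnS mn.
have := @leq_nacciS K m K1 ltac:(lia).
by have := @nacci_addn_le K m ltac:(lia); lia.
Qed.

Lemma dvdn_exp2_fact m : 2 ^ m./2 %| m`!.
Proof.
elim/ltn_ind: m => -[|[|m]] IHm //=.
rewrite !factS expnS mulnA dvdn_mul ?IHm //.
by rewrite dvdn2 oddM /=; case: odd.
Qed.

Lemma fact_le_exp2 m : m`! <= 2 ^ (m * m).
Proof.
elim: m => // m IHm; rewrite factS.
apply: leq_trans (leq_mul (ltnW (ltn_expl _ (ltnSn 1))) IHm) _.
by rewrite -expnD leq_exp2l //; lia.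
Qed.

Lemma ltn_pronic_exp2 e : 5 <= e -> e * e.+1 < 2 ^ e.
Proof.
elim: e => // e IHe; rewrite leq_eqVlt => /predU1P[<- //|].
by rewrite ltnS => /[dup] e5 /IHe; rewrite expnS; nia.
Qed.

(** For such m the base on the left is at most m ^ 4, so with
2 ^ e <= m < 2 ^ e.+1 it suffices that 4 d (e + 1) < 2 ^ e.-1; this holds because
8 d <= e and e (e + 1) < 2 ^ e. *)
Lemma exp2_half_gt K d m : 0 < d -> 2 ^ (8 * d) + K + 6 <= m ->
  (2 * (K + 1 + 2 * m ^ 2) * K) ^ d < 2 ^ m./2.
Proof.
move=> d0 mM.
have m0 : 0 < m by lia.
have base_le : 2 * (K + 1 + 2 * m ^ 2) * K <= m ^ 4.
  have Km : K.+1 <= m by lia.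
  have m6 : 6 <= m by lia.
  apply: (@leq_trans (6 * m ^ 3)); last by rewrite (expnS m 3) leq_mul2r m6 orbT.
  rewrite !expnS expn0 !muln1.
  have : (2 * (K + 1 + 2 * (m * m))) * K <= (2 * (m * m + 2 * (m * m))) * m.
    by apply: leq_mul; nia.
  by lia.
set e := trunc_log 2 m.
have em : m < 2 ^ e.+1 by apply: trunc_log_ltn.
have me : 2 ^ e <= m by apply: trunc_logP.
have de : 8 * d <= e by rewrite -ltnS -(ltn_exp2l _ _ (ltnSn 1)); lia.
apply: (@leq_ltn_trans ((m ^ 4) ^ d)); first by rewrite leq_exp2r.
apply: (@leq_ltn_trans (((2 ^ e.+1) ^ 4) ^ d)).
  by rewrite leq_exp2r // leq_exp2r // ltnW.
rewrite -!expnM ltn_exp2l //.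
have := @ltn_pronic_exp2 e ltac:(lia).
have : 2 * (2 ^ e)./2 = 2 ^ e.
  by rewrite -[in 2 ^ e](@prednK e) ?expnS; lia.
have : (2 ^ e)./2 <= m./2 by apply: half_leq.
have : 8 * d * e.+1 <= e * e.+1 by rewrite leq_mul2r de orbT.
by lia.
Qed.

(** * An explicit box containing all solutions *)

Lemma pfactor_prod_le p d (f : 'I_d -> nat) c : (forall i, 0 < f i) ->
  (forall i, p ^ logn p (f i) <= c) -> p ^ logn p (\prod_(i < d) f i) <= c ^ d.
Proof.
move=> f0 fc.
have [_ ->] : 0 < \prod_(i < d) f i
    /\ p ^ logn p (\prod_(i < d) f i) = \prod_(i < d) p ^ logn p (f i).
  elim/big_ind2: _ => [|x x' y y' [x0 Ex] [y0 Ey]|i _]; rewrite ?logn1 //.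
  by rewrite muln_gt0 x0 y0 lognM // expnD Ex Ey.
by rewrite -[d in c ^ d]card_ord -prod_nat_const leq_prod.
Qed.

Definition max_fact K d := 2 ^ (8 * d) + K + 6.
Definition max_index K d := K + 1 + 2 * max_fact K d ^ 2.

Lemma solutions_bounded k d x : 2 <= k -> 0 < d -> solutions k d x ->
  x.1 <= max_fact (2 * k) d
  /\ forall i, tnth x.2 i <= max_index (2 * k) d.
Proof.
case: x => m v; set K := 2 * k => k2 d0 [/= m0 v0 mv].
have K1 : 1 < K by rewrite /K; lia.
have t0 i : 0 < nacci K (tnth v i) by rewrite nacci_gt0.
have v_le i : tnth v i <= K + 1 + 2 * m ^ 2.
  have : 2 ^ (tnth v i - K)./2 <= 2 ^ (m * m).
    apply: leq_trans (leq_exp2_nacci _ _) _ => //.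
    apply: leq_trans (fact_le_exp2 m); apply: dvdn_leq; first exact: fact_gt0.
    by rewrite mv (bigD1 i) //= dvdn_mulr.
  by rewrite leq_exp2l // mulnn; lia.
have m_le : m <= max_fact K d.
  rewrite leqNgt; apply/negP => /ltnW /(exp2_half_gt d0); rewrite ltnNge.
  move/negP; apply; apply: (@leq_trans (2 ^ logn 2 m`!)).
    by rewrite leq_exp2l // -pfactor_dvdn ?fact_gt0 // dvdn_exp2_fact.
  rewrite mv; apply: pfactor_prod_le => // i.
  apply: leq_trans (pfactor_nacci_le _ _ _) _ => //; try by rewrite /K; lia.
  by rewrite leq_mul2r leq_mul2l v_le !orbT.
split=> //= i; apply: leq_trans (v_le i) _.
by rewrite /max_index leq_add2l leq_mul2l leq_exp2r.
Qed.

Definition solution_bound k d :=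
  (max_fact (2 * k) d).+1 * (max_index (2 * k) d).+1 ^ d.

Lemma solutions_card k d : 2 <= k -> 0 < d ->
  finite_set (solutions k d) /\
  #|` fset_set (solutions k d)| <= solution_bound k d.
Proof.
move=> k2 d0; set M := max_fact (2 * k) d; set N := max_index (2 * k) d.
pose box : {fset nat * d.-tuple nat} :=
  [fset (val y.1, map_tuple val y.2)
    | y : 'I_M.+1 * d.-tuple 'I_N.+1 in predT]%fset.
have sub : (solutions k d `<=` [set` box])%classic.
  move=> x /(solutions_bounded k2 d0) [xM xN]; apply/imfsetP => /=.
  exists (inord x.1, map_tuple inord x.2) => //=.
  case: x xM xN => m v /= mM vN; rewrite inordK //; congr pair.
  by apply: eq_from_tnth => i; rewrite !tnth_map inordK ?ltnS ?vN.
have fin : finite_set (solutions k d) by apply: sub_finite_set (finite_fset box).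
split=> //; apply: (@leq_trans #|` box|).
  by apply/fsubset_leq_card/fsubsetP => x; rewrite in_fset_set // inE => /sub.
apply: leq_trans (leq_imfset_card _ _ _) _.
by rewrite -cardE card_prod card_tuple !card_ord.
Qed.

(** * The bound is a recursive function *)

Lemma recursive_comp2 n B (f g : n.-tuple nat -> nat) :
  recursive2 B -> recursive f -> recursive g ->
  recursive (fun v => B (f v) (g v)).
Proof.
move=> rB rf rg; pose h (i : 'I_2) := if i == ord0 then f else g.
have rh i : recursive (h i) by rewrite /h; case: eqP.
by apply: recursive_ext (recursive_comp rB rh) _ => v /=; rewrite !tnth_mktuple.
Qed.

Lemma recursive_S n (f : n.-tuple nat -> nat) :
  recursive f -> recursive (fun v => (f v).+1).
Proof.
move=> rf; apply: recursive_ext (recursive_comp recursive_succ (fun=> rf)) _.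
by move=> v; rewrite /thead tnth_mktuple.
Qed.

Lemma recursive_const n c : recursive (fun _ : n.-tuple nat => c).
Proof.
by elim: c => [|c IHc]; [apply: recursive_zero | apply: (recursive_S IHc)].
Qed.

Lemma recursive2_iter (g : nat -> nat) (h : nat -> nat -> nat) :
  recursive (fun v : 1.-tuple nat => g (thead v)) -> recursive2 h ->
  recursive2 (fun a b => iter a (h b) (g b)).
Proof.
move=> rg rh; pose h' (w : 3.-tuple nat) := h (tnth w ord_max) (tnth w (inord 1)).
have rh' : recursive h' by apply: recursive_comp2 => //; apply: recursive_proj.
apply: recursive_ext (recursive_prim rg rh') _ => v.
case/tupleP: v => a v; case/tupleP: v => b v; rewrite !theadE.
have -> : tnth [tuple of a :: [tuple of b :: v]] ord0 = a by [].
have -> : tnth [tuple of a :: [tuple of b :: v]] ord_max = b by [].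
have -> : thead (behead_tuple [tuple of a :: [tuple of b :: v]]) = b by [].
rewrite (@eq_iteri _ _ (fun=> h b)); first by elim: a => //= a ->.
by move=> i r; rewrite /h' !(tnth_nth 0) /= inordK.
Qed.

Lemma recursive2_add : recursive2 addn.
Proof.
have := @recursive2_iter id (fun _ r => r.+1).
move=> /(_ (recursive_proj _) (recursive_S (recursive_proj _))).
by move/recursive_ext; apply=> v; elim: (tnth v ord0) => //= a ->.
Qed.

Lemma recursive2_mul : recursive2 muln.
Proof.
have := @recursive2_iter (fun=> 0) addn (recursive_const _ _) recursive2_add.
by move/recursive_ext; apply=> v; elim: (tnth v ord0) => //= a ->; rewrite mulSn.
Qed.

Lemma recursive2_exp : recursive2 expn.
Proof.
have rexp : recursive2 (fun a b => b ^ a).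
  have := @recursive2_iter (fun=> 1) muln (recursive_const _ _) recursive2_mul.
  move/recursive_ext; apply=> v.
  by elim: (tnth v ord0) => //= a ->; rewrite expnS.
exact: recursive_comp2 rexp (recursive_proj _) (recursive_proj _).
Qed.

Lemma recursive2_solution_bound : recursive2 solution_bound.
Proof.
have rc c : recursive (fun _ : 2.-tuple nat => c) by apply: recursive_const.
have rk : recursive (fun v : 2.-tuple nat => 2 * tnth v ord0).
  exact: recursive_comp2 recursive2_mul (rc 2) (recursive_proj _).
have rd : recursive (fun v : 2.-tuple nat => tnth v ord_max).
  exact: recursive_proj.
have rM : recursive
    (fun v : 2.-tuple nat => max_fact (2 * tnth v ord0) (tnth v ord_max)).
  apply: (recursive_comp2 recursive2_add _ (rc 6)).
  apply: (recursive_comp2 recursive2_add _ rk).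
  apply: (recursive_comp2 recursive2_exp (rc 2)).
  exact: (recursive_comp2 recursive2_mul (rc 8) rd).
apply: (recursive_comp2 recursive2_mul (recursive_S rM)).
apply: (recursive_comp2 recursive2_exp _ rd); apply: recursive_S.
apply: (recursive_comp2 recursive2_add).
  exact: (recursive_comp2 recursive2_add rk (rc 1)).
apply: (recursive_comp2 recursive2_mul (rc 2)).
exact: (recursive_comp2 recursive2_exp rM (rc 2)).
Qed.

Theorem corollary5 :
  exists B : nat -> nat -> nat,
    recursive2 B /\
    forall k d : nat, 2 <= k -> 0 < d ->
      finite_set (solutions k d) /\
      #|` fset_set (solutions k d)| <= B k d.
Proof.
exists solution_bound; split; first exact: recursive2_solution_bound.
exact: solutions_card.
Qed.
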